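(* Let $A$ be an $n\times n$ real symmetric matrix, let $P$ be an $n\times n$ real symmetric positive definite matrix, and suppose that they have eigenvalue decompositions $A=W\Lambda W^*$ and $P=W\Sigma W^*$ with the same orthogonal matrix $W$ and with $\Lambda,\Sigma$ diagonal. Let $\mathbf{b}$ be an $n\times 1$ vector and let $G(x)=Ax+\mathbf{b}$. Suppose that the eigenvalues of $A$ are contained in an interval $[a,b]$, $a<b$, that contains neither $0$ nor $1$. Let $x^*$ be the fixed point of $G$, let $1\le m\le n$ and $k\ge m$ be integers, let $x_0$ be an initial vector, and suppose that $x_{j+1}=Ax_j+\mathbf{b}$ for $0\le j\le k-1$ and that $x_{k+1}$ is produced from $x_0,\dots,x_k$ by one step of Anderson acceleration with memory parameter $m$ and distance function $d(v,w)=\|P(v-w)\|_2$. Write $e_j=x_j-x^*$, $D_\mu=\Lambda(\Lambda-I)^{-1}$, $H=(\Lambda-I)^2\Lambda^{k-m}$, and $K_H=K_m(\Lambda,HW^*e_0)$, and assume that $K_H$ has linearly independent columns. Then $$\frac{\|\Sigma D_\mu^{-1}W^*e_{k+1}\|_2}{\max_{1\le i\le n}|\Sigma_{ii}|}\le C(a,b,m)\,\|D_\mu^{-1}W^*Ae_k\|_2,\qquad C(a,b,m)=\left|T_m\!\left(\frac{2ab-a-b}{b-a}\right)\right|^{-1},$$ where $T_m$ is the Chebyshev polynomial (of the first kind) of degree $m$.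
   Context: Krylov matrix: for an $n\times n$ matrix $M$ and an $n\times 1$ vector $v$, $K_m(M,v)=\begin{bmatrix}v & Mv & \cdots & M^{m-1}v\end{bmatrix}\in\mathbb{C}^{n\times m}$. One step of Anderson acceleration (AA) with memory parameter $m$ and distance function $d(v,w)=\|P(v-w)\|_2$: given $x_0,\dots,x_k$ with $k\ge m$, set $f_i=G(x_i)-x_i$, $\Delta f_i=f_{i+1}-f_i$, and $D_k=[\Delta f_{k-m},\dots,\Delta f_{k-1}]\in\mathbb{C}^{n\times m}$. Let $\gamma=(\gamma_0,\dots,\gamma_{m-1})^T$ be the minimizer of $\|P(f_k-D_kv)\|_2$ over $v\in\mathbb{C}^m$, and set $$x_{k+1}=G(x_k)-\sum_{i=0}^{m-1}\gamma_i\left[G(x_{k-m+i+1})-G(x_{k-m+i})\right].$$ Equivalently, when $D_k$ has linearly independent columns and $X_k=[\Delta x_{k-m},\dots,\Delta x_{k-1}]$ with $\Delta x_i=x_{i+1}-x_i$, one has $x_{k+1}=x_k+(I-\tilde S_k)f_k$ with $\tilde S_k=(X_k+D_k)(D_k^*P^2D_k)^{-1}D_k^*P^2$. *)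

(* Defs.v *)
From HB Require Import structures.
From mathcomp Require Import all_boot all_order all_algebra.
From mathcomp Require Import complex reals.

Set Implicit Arguments.
Unset Strict Implicit.
Unset Printing Implicit Defensive.

Import Order.TTheory GRing.Theory Num.Theory.

Local Open Scope ring_scope.

(* Vectors have complex entries; a real matrix acts on them through its
   entrywise embedding. *)
Definition toC (R : realType) (m n : nat) (M : 'M[R]_(m, n)) : 'M[R[i]]_(m, n) :=
  map_mx (real_complex R) M.

Definition norm2 (R : realType) (n : nat) (v : 'cV[R[i]]_n) : R :=
  Num.sqrt (\sum_(i < n) Normc.normc (v i 0) ^+ 2).

Definition symmetric_mx (R : realType) (n : nat) (M : 'M[R]_n) : Prop :=
  M^T = M.

Definition positive_definite (R : realType) (n : nat) (M : 'M[R]_n) : Prop :=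
  forall v : 'cV[R]_n, v != 0 -> 0 < (v^T *m M *m v) 0 0.

Definition orthogonal_mx (R : realType) (n : nat) (W : 'M[R]_n) : Prop :=
  W *m W^T = 1%:M /\ W^T *m W = 1%:M.

Definition krylov (F : fieldType) (n m : nat) (M : 'M[F]_n) (v : 'cV[F]_n) :
    'M[F]_(n, m) :=
  \matrix_(i < n, j < m) (M ^+ j *m v) i 0.

Definition col_free (F : fieldType) (n m : nat) (K : 'M[F]_(n, m)) : bool :=
  row_free K^T.

Fixpoint chebyshevT (R : nzRingType) (m : nat) : {poly R} :=
  match m with
  | 0 => 1
  | p.+1 => match p with
            | 0 => 'X
            | q.+1 => 2%:R *: ('X * chebyshevT R p) - chebyshevT R q
            end
  end.

Section AndersonAcceleration.

Variables (R : realType) (n : nat).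
Variables (d : 'cV[R[i]]_n -> 'cV[R[i]]_n -> R).
Variables (G : 'cV[R[i]]_n -> 'cV[R[i]]_n).
Variables (m k : nat) (x : nat -> 'cV[R[i]]_n).

Definition aa_f (i : nat) : 'cV[R[i]]_n := G (x i) - x i.

Definition aa_df (i : nat) : 'cV[R[i]]_n := aa_f i.+1 - aa_f i.

Definition aa_D : 'M[R[i]]_(n, m) :=
  \matrix_(i < n, j < m) aa_df (k - m + j) i 0.

Definition aa_minimizer (gamma : 'cV[R[i]]_m) : Prop :=
  forall v : 'cV[R[i]]_m,
    d (aa_f k) (aa_D *m gamma) <= d (aa_f k) (aa_D *m v).

(* Meaningful for m <= k only, because of the truncated subtraction k - m. If
   the columns of aa_D are dependent the minimizer need not be unique, and any
   minimizer is accepted. *)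
Definition aa_step : Prop :=
  exists2 gamma : 'cV[R[i]]_m, aa_minimizer gamma &
    x k.+1 = G (x k) -
      \sum_(i < m) gamma i 0 *: (G (x (k - m + i).+1) - G (x (k - m + i)%N)).

End AndersonAcceleration.

Definition weighted_dist (R : realType) (n : nat) (P : 'M[R]_n)
    (v w : 'cV[R[i]]_n) : R :=
  norm2 (toC P *m (v - w)).

Definition affine_map (R : realType) (n : nat) (A : 'M[R]_n)
    (c x : 'cV[R[i]]_n) : 'cV[R[i]]_n :=
  toC A *m x + c.

(* invmx is the identity on singular matrices, so this is the intended matrix
   only when 1 is not an eigenvalue of Lam. *)
Definition Dmu (R : realType) (n : nat) (Lam : 'M[R]_n) : 'M[R]_n :=
  Lam *m invmx (Lam - 1%:M).

Definition aa_rate (R : realType) (a b : R) (m : nat) : R :=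
  `| (chebyshevT R m).[(2%:R * a * b - a - b) / (b - a)] |^-1.

Definition max_abs_diag (R : realType) (n : nat) (S : 'M[R]_n) : R :=
  \big[Num.max/0]_(i < n) `|S i i|.

(* Main.v *)
(* In the coordinates given by [W], the error after the Anderson step satisfies
   D_mu^{-1} W^* e_{k+1} = W^* (f_k - D_k gamma), so minimality of gamma bounds
   its Sig-weighted norm by that of W^* (f_k - D_k v) for every v. The entries of
   the latter are (lam - 1) lam^{k-m} r(lam) u_0, where r(z) = z^m - (z - 1) q(z)
   and q is the polynomial of degree < m with coefficients v, i.e. r is an
   arbitrary polynomial of degree <= m with r(1) = 1. Since
   D_mu^{-1} W^* A e_k has entries (lam - 1) lam^k u_0, it remains to choose r
   with |r(lam)| <= C |lam|^m on [a, b]; take the reversal of the Chebyshev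
   polynomial of [1/b, 1/a] normalized at 1. *)
Require Import Defs.
From HB Require Import structures.
From mathcomp Require Import all_boot all_order all_algebra.
From mathcomp Require Import complex reals.
From mathcomp Require Import ring lra.

Set Implicit Arguments.
Unset Strict Implicit.
Unset Printing Implicit Defensive.

Import Order.TTheory GRing.Theory Num.Theory.

Local Open Scope ring_scope.

(** * Chebyshev polynomials and the residual polynomial built from them *)

Lemma size_chebyshevT (R : nzRingType) (m : nat) :
  (size (chebyshevT R m) <= m.+1)%N.
Proof.
suff [] : (size (chebyshevT R m) <= m.+1)%N /\
          (size (chebyshevT R m.+1) <= m.+2)%N by [].
elim: m => [|m [IH1 IH2]]; first by rewrite /= size_poly1 size_polyX.
split=> //.
rewrite -[chebyshevT R m.+2]/(2%:R *: ('X * chebyshevT R m.+1) - chebyshevT R m).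
rewrite (leq_trans (size_polyD _ _)) // geq_max size_polyN.
rewrite (leq_trans IH1) ?andbT; last by rewrite ltnW.
rewrite (leq_trans (size_scale_leq _ _)) // -commr_polyX.
by rewrite (leq_trans (size_polyMleq _ _)) // size_polyX addn2.
Qed.

(* [u] is the value at [x] of the Chebyshev polynomial of the second kind of
   degree [m - 1]. *)
Lemma chebyshevT_pell (R : comNzRingType) (m : nat) (x : R) :
  exists u : R, (chebyshevT R m).[x] ^+ 2 = 1 + (x ^+ 2 - 1) * u ^+ 2.
Proof.
(* The second conjunct links consecutive degrees, so the two-step recurrence closes with the same
   [u]. *)
suff [u []] : exists u : R,
    (chebyshevT R m).[x] ^+ 2 = 1 + (x ^+ 2 - 1) * u ^+ 2 /\
    (chebyshevT R m.+1).[x] = x * (chebyshevT R m).[x] + (x ^+ 2 - 1) * u.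
  by exists u.
elim: m => [|m [u [IH1 IH2]]].
  by exists 0; rewrite /= hornerX hornerC; split; ring.
exists (x * u + (chebyshevT R m).[x]).
rewrite -[chebyshevT R m.+2]/(2%:R *: ('X * chebyshevT R m.+1) - chebyshevT R m).
rewrite hornerD hornerN hornerZ hornerM hornerX IH2.
move: (chebyshevT R m).[x] IH1 => t IH1; split; last by ring.
apply/eqP; rewrite -subr_eq0; apply/eqP.
by transitivity (t ^+ 2 - (1 + (x ^+ 2 - 1) * u ^+ 2)); [ring | rewrite IH1 subrr].
Qed.

(** The Pell term [(x ^+ 2 - 1) * u ^+ 2] is nonpositive here; outside the interval its sign flips,
    which gives the lower bound of [chebyshevT_ge1]. *)
Lemma chebyshevT_le1 (R : realDomainType) (m : nat) (x : R) :
  `|x| <= 1 -> `|(chebyshevT R m).[x]| <= 1.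
Proof.
have [u Tu] := chebyshevT_pell m x; move=> x1.
rewrite -(@expr_le1 _ 2) // real_normK ?num_real // Tu.
have : x ^+ 2 <= 1 by rewrite -real_normK ?num_real // expr_le1.
by move=> x21; rewrite gerDl mulr_le0_ge0 ?sqr_ge0 // subr_le0.
Qed.

Lemma chebyshevT_ge1 (R : realDomainType) (m : nat) (x : R) :
  1 <= x ^+ 2 -> 1 <= `|(chebyshevT R m).[x]|.
Proof.
have [u Tu] := chebyshevT_pell m x => x1.
rewrite -(@expr_ge1 _ 2) // real_normK ?num_real // Tu lerDl.
by rewrite mulr_ge0 ?sqr_ge0 // subr_ge0.
Qed.

(** Multiplying by [z ^+ m] clears denominators term by term: [(c / z + d) ^+ i] becomes
    [(c + d * z) ^+ i * z ^+ (m - i)]. *)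
Lemma homogenize_poly (F : fieldType) (m : nat) (p : {poly F}) (c d : F) :
  (size p <= m.+1)%N ->
  exists2 r : {poly F}, (size r <= m.+1)%N &
    forall z, z != 0 -> r.[z] = z ^+ m * p.[c / z + d].
Proof.
move=> sp.
exists (\sum_(i < m.+1) p`_i *: ((c%:P + d *: 'X) ^+ i * 'X^(m - i))).
  apply: (leq_trans (size_sum _ _ _)); apply/bigmax_leqP => i _.
  apply: (leq_trans (size_scale_leq _ _)).
  apply: (leq_trans (size_polyMleq _ _)); rewrite size_polyXn addnS /=.
  have sl : (size (c%:P + d *: 'X)%R <= 2)%N.
    rewrite (leq_trans (size_polyD _ _)) // geq_max.
    rewrite (leq_trans (size_polyC_leq1 _)) //=.
    by rewrite (leq_trans (size_scale_leq _ _)) // size_polyX.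
  have se : (size ((c%:P + d *: 'X) ^+ i)%R <= i.+1)%N.
    apply: (leq_trans (size_poly_exp_leq _ _)); rewrite ltnS.
    by rewrite -[X in (_ <= X)%N]mul1n leq_mul2r -subn1 leq_subLR sl orbT.
  by rewrite (leq_trans (leq_add se (leqnn _))) // addSn subnKC // -ltnS.
move=> z z0; rewrite (horner_coef_wide _ sp) mulr_sumr horner_sum.
apply: eq_bigr => i _; rewrite !hornerE.
have im : (i <= m)%N by rewrite -ltnS.
rewrite -[X in z ^+ X](subnK im) exprD.
have -> : c + d * z = z * (c / z + d) by field.
rewrite exprMn; move: (m - i)%N (c / z + d) => j y /=; ring.
Qed.

(* The substitution [z = 1 / lam] turns the constraint into "degree at most [m]
   and value [1] at [1]" and the interval into [1/b, 1/a], where the shifted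
   Chebyshev polynomial is optimal. *)
Lemma chebyshev_residual (R : realFieldType) (m : nat) (a b : R) :
  a < b -> 0 \notin `[a, b] -> 1 \notin `[a, b] ->
  exists2 q : {poly R}, (size q <= m)%N &
    forall lam, lam \in `[a, b] ->
      `|lam ^+ m - (lam - 1) * q.[lam]|
        <= `|(chebyshevT R m).[(2%:R * a * b - a - b) / (b - a)]|^-1
           * `|lam| ^+ m.
Proof.
rewrite !in_itv /= => ab n0 n1.
have ba : b - a != 0 by lra.
(* An interval avoiding 0 and 1 has both endpoints on the same side of each. *)
have [ab0 ab1] : 0 < a * b /\ 0 < (a - 1) * (b - 1) by nra.
set l := _ / (b - a).
have l1 : 1 <= l ^+ 2.
  rewrite -subr_ge0.
  have -> : l ^+ 2 - 1 = 4%:R * (a * b) * ((a - 1) * (b - 1)) / (b - a) ^+ 2.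
    by rewrite /l; field.
  by rewrite divr_ge0 ?sqr_ge0 // mulr_ge0 ?(ltW ab1) // mulr_ge0 // ltW.
have := chebyshevT_ge1 m l1; set t := _.[l] => t1.
have t0 : t != 0 by rewrite -normr_gt0 (lt_le_trans ltr01).
(* The map [z |-> (2ab / z - (a + b)) / (b - a)] sends [a] to 1, [b] to -1 and 1 to [l]. *)
have [r sr rE] := homogenize_poly (2%:R * a * b / (b - a)) (- (a + b) / (b - a))
  (size_chebyshevT R m).
have r1 : r.[1] = t.
  by rewrite rE ?oner_neq0 // expr1n mul1r /t /l; congr (_.[_]); field.
(* Normalized to agree with ['X^m] at 1, [r] differs from it by a multiple of ['X - 1]; the cofactor
   is [q]. *)
have : root ('X^m - t^-1 *: r) 1.
  by rewrite rootE !hornerE r1 expr1n mulVf ?subrr.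
case/factor_theorem => q qE; exists q.
  have [->|q0] := eqVneq q 0; first by rewrite size_poly0.
  have := size_Mmonic q0 (monicXsubC 1); rewrite -qE size_XsubC addn2 /= => sq.
  rewrite -ltnS -sq (leq_trans (size_polyD _ _)) // geq_max size_polyXn leqnn.
  by rewrite size_polyN (leq_trans (size_scale_leq _ _)).
move=> lam lamab.
have lam0 : lam != 0 by apply: contraNneq n0 => <-.
have -> : lam ^+ m - (lam - 1) * q.[lam] = t^-1 * r.[lam].
  have := congr1 (horner^~ lam) qE; rewrite /= !hornerE => e.
  by rewrite [(lam - 1) * _]mulrC -e; ring.
rewrite rE // !normrM normfV normrX ler_wpM2l ?invr_ge0 // ler_piMr ?exprn_ge0 //.
apply: chebyshevT_le1; rewrite ler_norml.
have -> : 2%:R * a * b / (b - a) / lam + - (a + b) / (b - a) =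
  (2%:R * (a * b) - (a + b) * lam) / (lam * (b - a)) by field; rewrite ba.
move: lamab; rewrite in_itv /= => /andP[la lb].
(* Once the denominator is cleared according to its sign, the two bounds compare [b * lam] and
   [a * lam] with [a * b]. *)
have [lam_gt0|lam_lt0] : 0 < lam \/ lam < 0 by move: lam0; rewrite neq_lt; lra.
  have p0 : 0 < lam * (b - a) by nra.
  rewrite ler_pdivlMr // ler_pdivrMr //.
  have b0 : 0 < b by lra.
  have a0 : 0 < a by rewrite -(pmulr_lgt0 _ b0).
  by apply/andP; split; nra.
have p0 : lam * (b - a) < 0 by nra.
rewrite ler_ndivlMr // ler_ndivrMr //.
have a0 : a < 0 by lra.
have b0 : b < 0 by rewrite -(nmulr_rgt0 _ a0).
by apply/andP; split; nra.
Qed.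

(** * Real matrices acting on complex vectors, and the Euclidean norm *)

Lemma toCM (R : realType) (m n p : nat) (M : 'M[R]_(m, n)) (N : 'M[R]_(n, p)) :
  toC (M *m N) = toC M *m toC N.
Proof. exact: map_mxM. Qed.

Lemma toC_diagE (R : realType) (n : nat) (d : 'rV[R]_n) (v : 'cV[R[i]]_n)
    (i : 'I_n) :
  (toC (diag_mx d) *m v) i 0 = (d 0 i)%:C%C * v i 0.
Proof.
rewrite mxE (bigD1 i) //= big1 ?addr0 => [|j ji].
  by rewrite !mxE eqxx mulr1n.
by rewrite !mxE eq_sym (negPf ji) mulr0n rmorph0 mul0r.
Qed.

Lemma normc_sqr_conj (R : realType) (z : R[i]) :
  ((Normc.normc z ^+ 2)%:C)%C = z^*%C * z.
Proof.
case: z => p q; rewrite /= sqr_sqrtr ?addr_ge0 ?sqr_ge0 //.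
by apply/eqP; rewrite eq_complex /=; apply/andP; split; apply/eqP; ring.
Qed.

Lemma normc_ge0 (R : realType) (z : R[i]) : 0 <= Normc.normc z.
Proof. by case: z => p q; rewrite sqrtr_ge0. Qed.

Lemma normc_real (R : realType) (t : R) : Normc.normc t%:C%C = `|t|.
Proof. by rewrite /= expr0n /= addr0 sqrtr_sqr. Qed.

Lemma norm2_ge0 (R : realType) (n : nat) (v : 'cV[R[i]]_n) : 0 <= norm2 v.
Proof. exact: sqrtr_ge0. Qed.

(** The squared norm is the conjugate transpose of [u] times [u], and conjugation fixes the real
    matrix [W]. *)
Lemma norm2_orthogonal (R : realType) (n : nat) (W : 'M[R]_n)
    (v : 'cV[R[i]]_n) :
  W^T *m W = 1%:M -> norm2 (toC W *m v) = norm2 v.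
Proof.
move=> WW; rewrite /norm2; congr Num.sqrt.
have sqE (u : 'cV[R[i]]_n) :
    ((\sum_(i < n) Normc.normc (u i 0) ^+ 2)%:C)%C
      = ((map_mx (@conjc R) u)^T *m u) 0 0.
  rewrite rmorph_sum mxE; apply: eq_bigr => i _.
  by rewrite !mxE; exact: normc_sqr_conj.
apply: (@complexI R); rewrite !sqE map_mxM.
have -> : map_mx (@conjc R) (toC W) = toC W.
  by apply/matrixP => i j; rewrite !mxE; exact: conjc_real.
rewrite trmx_mul -mulmxA [_ *m (toC W *m v)]mulmxA.
have -> : (toC W)^T = toC W^T by apply/matrixP => i j; rewrite !mxE.
by rewrite -toCM WW /toC map_mx1 mul1mx.
Qed.

Lemma norm2_le_scale (R : realType) (n : nat) (c : R) (v w : 'cV[R[i]]_n) :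
  0 <= c ->
  (forall i, Normc.normc (v i 0) <= c * Normc.normc (w i 0)) ->
  norm2 v <= c * norm2 w.
Proof.
move=> c0 vw; rewrite -(ger0_norm c0) -sqrtr_sqr -sqrtrM ?sqr_ge0 //.
rewrite ler_wsqrtr // mulr_sumr ler_sum // => i _.
by rewrite -exprMn lerXn2r ?nnegrE ?mulr_ge0 ?normc_ge0.
Qed.

(** * Diagonal matrices and their orthogonal conjugates *)

Lemma invmx_diag (F : fieldType) (n : nat) (d : 'rV[F]_n) :
  (forall i, d 0 i != 0) -> invmx (diag_mx d) = diag_mx (map_mx GRing.inv d).
Proof.
move=> d0; have dV : diag_mx d *m diag_mx (map_mx GRing.inv d) = 1%:M.
  rewrite mulmx_diag -diag_const_mx; congr diag_mx.
  by apply/rowP => i; rewrite !mxE divff.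
have [du _] := mulmx1_unit dV.
by rewrite -[RHS](mulKmx du) dV mulmx1.
Qed.

(** Entries different from 1 and 0 make both uses of [invmx] genuine inverses. *)
Lemma invmx_Dmu_diag (R : realType) (n : nat) (d : 'rV[R]_n) :
  (forall i, d 0 i != 0) -> (forall i, d 0 i != 1) ->
  invmx (Dmu (diag_mx d)) = diag_mx (\row_i ((d 0 i - 1) / d 0 i)).
Proof.
move=> d0 d1.
have -> : Dmu (diag_mx d) = diag_mx (\row_i (d 0 i / (d 0 i - 1))).
  rewrite /Dmu -diag_const_mx -linearB /= invmx_diag.
    rewrite mulmx_diag; congr diag_mx.
    by apply/rowP => i; rewrite !mxE.
  by move=> i; rewrite !mxE subr_eq0.
rewrite invmx_diag; last first.
  by move=> i; rewrite mxE mulf_neq0 // invr_eq0 subr_eq0.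
by congr diag_mx; apply/rowP => i; rewrite !mxE invf_div.
Qed.

Lemma eigenvalue_diag_conj (F : fieldType) (n : nat) (W : 'M[F]_n)
    (d : 'rV[F]_n) (i : 'I_n) :
  W *m W^T = 1%:M -> eigenvalue (W *m diag_mx d *m W^T) (d 0 i).
Proof.
move=> WWt; have WtW : W^T *m W = 1%:M by apply: mulmx1C.
(* [eigenvalue] is about row vectors, so the witness is row [i] of [W^T]. *)
apply/eigenvalueP; exists (delta_mx 0 i *m W^T).
  rewrite !mulmxA -[_ *m W^T *m W]mulmxA WtW mulmx1 scalemxAl; congr (_ *m _).
  apply/rowP => j; rewrite mul_mx_diag !mxE !eqxx /=.
  by have [->|] := eqVneq j i; rewrite ?mul1r ?mulr1 ?mul0r ?mulr0.
apply: contraTneq isT => /(congr1 (mulmx^~ W)).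
rewrite -mulmxA WtW mulmx1 mul0mx => /matrixP/(_ 0 i)/eqP.
by rewrite !mxE !eqxx oner_eq0.
Qed.

Lemma norm_le_max_abs_diag (R : realType) (n : nat) (S : 'M[R]_n) (i : 'I_n) :
  `|S i i| <= max_abs_diag S.
Proof. exact: (le_bigmax _ (fun i => `|S i i|)). Qed.

(** * The Anderson step in the eigenbasis of [A] *)

Theorem theorem3p2 (R : realType) (n : nat)
    (A P W Lam Sig : 'M[R]_n)
    (A_sym : symmetric_mx A)
    (P_sym : symmetric_mx P) (P_pd : positive_definite P)
    (W_orth : orthogonal_mx W)
    (Lam_diag : is_diag_mx Lam) (Sig_diag : is_diag_mx Sig)
    (A_dec : A = W *m Lam *m W^T) (P_dec : P = W *m Sig *m W^T)
    (bvec : 'cV[R[i]]_n)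
    (a b : R) (lt_ab : a < b)
    (ab0 : 0 \notin `[a, b]) (ab1 : 1 \notin `[a, b])
    (A_spec : forall lam : R, eigenvalue A lam -> lam \in `[a, b])
    (xs : 'cV[R[i]]_n) (xs_fix : affine_map A bvec xs = xs)
    (m k : nat) (m_gt0 : (1 <= m)%N) (le_mn : (m <= n)%N) (le_mk : (m <= k)%N)
    (x : nat -> 'cV[R[i]]_n)
    (x_iter : forall j : nat, (j < k)%N -> x j.+1 = affine_map A bvec (x j))
    (x_aa : aa_step (weighted_dist P) (affine_map A bvec) m k x) :
  let e (j : nat) : 'cV[R[i]]_n := x j - xs in
  let H : 'M[R]_n := (Lam - 1%:M) ^+ 2 *m Lam ^+ (k - m) in
  let KH : 'M[R[i]]_(n, m) :=
    krylov m (toC Lam) (toC H *m toC W^T *m e 0%N) in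
  col_free KH ->
  norm2 (toC Sig *m toC (invmx (Dmu Lam)) *m toC W^T *m e k.+1)
      / max_abs_diag Sig
    <= aa_rate a b m
       * norm2 (toC (invmx (Dmu Lam)) *m toC W^T *m toC A *m e k).
Proof.
move=> e H KH _.
have [WWt WtW] := W_orth.
have /diag_mxP[l LamE] := Lam_diag; have /diag_mxP[s SigE] := Sig_diag.
have l_in i : l 0 i \in `[a, b].
  by apply: A_spec; rewrite A_dec LamE; apply: eigenvalue_diag_conj.
have l0 i : l 0 i != 0 by apply: contraNneq ab0 => <-.
have l1 i : l 0 i != 1 by apply: contraNneq ab1 => <-.
have lC0 i : ((l 0 i)%:C)%C != 0 by rewrite (fmorph_eq0 (real_complex R)).
have invD : invmx (Dmu Lam) = diag_mx (\row_i ((l 0 i - 1) / l 0 i)).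
  by rewrite LamE invmx_Dmu_diag.
(* Coordinates in the eigenbasis, where [A] acts as multiplication by [l 0 i]. *)
pose U (z : 'cV[R[i]]_n) i := (toC W^T *m z) i 0.
have UB z z' i : U (z - z') i = U z i - U z' i by rewrite /U mulmxBr !mxE.
have UA z i : U (toC A *m z) i = ((l 0 i)%:C)%C * U z i.
  rewrite /U -toC_diagE -LamE A_dec; congr ((_ : 'cV__) i 0).
  by rewrite !toCM !mulmxA -toCM WtW /toC map_mx1 mul1mx.
have Usum p (c : 'I_p -> R[i]) (z : 'I_p -> 'cV[R[i]]_n) i :
    U (\sum_j c j *: z j) i = \sum_j c j * U (z j) i.
  rewrite /U mulmx_sumr summxE; apply: eq_bigr => j _.
  by rewrite -scalemxAr mxE.
have GB z z' : affine_map A bvec z - affine_map A bvec z' = toC A *m (z - z').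
  by rewrite /affine_map mulmxBr opprD addrACA subrr addr0.
have Gxs z : affine_map A bvec z = toC A *m (z - xs) + xs.
  by rewrite -GB xs_fix subrK.
pose u j i := U (e j) i.
have uS j i : (j < k)%N -> u j.+1 i = ((l 0 i)%:C)%C * u j i.
  by move=> jk; rewrite /u /e x_iter // Gxs addrK UA.
pose w i := u (k - m)%N i.
(* The case [j = m] reaches [u k], the last error produced by plain iteration. *)
have uE j i : (j <= m)%N -> u (k - m + j)%N i = ((l 0 i)%:C)%C ^+ j * w i.
  elim: j => [|j IH] jm; first by rewrite addn0 mul1r.
  rewrite addnS uS ?IH ?(ltnW jm) ?exprS ?mulrA //.
  by rewrite -[X in (_ < X)%N](subnK le_mk) ltn_add2l.
have uk i : u k i = ((l 0 i)%:C)%C ^+ m * w i.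
  by rewrite -{1}(subnK le_mk) uE.
have Ux j j' i : U (x j - x j') i = u j i - u j' i.
  by rewrite -UB /e opprB addrA subrK.
have Uf j i : U (aa_f (affine_map A bvec) x j) i
    = (((l 0 i)%:C)%C - 1) * u j i.
  by rewrite /aa_f Gxs -addrA -[xs - x j]opprB UB UA mulrBl mul1r.
pose D := aa_D (affine_map A bvec) m k x.
pose f := aa_f (affine_map A bvec) x k.
have DE (v : 'cV[R[i]]_m) :
    D *m v = \sum_j v j 0 *: aa_df (affine_map A bvec) x (k - m + j).
  apply/colP => i; rewrite mxE summxE; apply: eq_bigr => j _.
  by rewrite !mxE mulrC.
have res v i : U (f - D *m v) i = (((l 0 i)%:C)%C - 1) *
    (u k i - \sum_j v j 0 * (u (k - m + j).+1 i - u (k - m + j)%N i)).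
  rewrite UB Uf DE Usum mulrBr mulr_sumr; congr (_ - _).
  by apply: eq_bigr => j _; rewrite /aa_df UB !Uf; ring.
have res_poly (q : {poly R}) i : (size q <= m)%N ->
    U (f - D *m \col_j ((q`_j)%:C)%C) i =
    (((l 0 i - 1) * (l 0 i ^+ m - (l 0 i - 1) * q.[l 0 i]))%:C)%C * w i.
  move=> sq; rewrite res uk (horner_coef_wide _ sq).
  rewrite !(rmorphM, rmorphB, rmorphXn, rmorph1, rmorph_sum) /= -mulrA.
  congr (_ * _); rewrite mulrBl -mulrA mulr_suml mulr_sumr; congr (_ - _).
  apply: eq_bigr => j _; rewrite -addnS !uE ?mxE ?(ltnW (ltn_ord j)) //.
  by rewrite !(rmorphM, rmorphXn) /= exprS; ring.
have distE z z' :
    weighted_dist P z z' = norm2 (toC Sig *m (toC W^T *m (z - z'))).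
  by rewrite /weighted_dist P_dec !toCM -!mulmxA norm2_orthogonal //.
case: x_aa => g g_min xk1.
(* The coordinates of the new error are [lam] times the bracket in [res]; the factor
   [(lam - 1) / lam] of the inverse of [Dmu Lam] turns this into the least-squares residual. *)
have errE : toC Sig *m toC (invmx (Dmu Lam)) *m toC W^T *m e k.+1 =
    toC Sig *m (toC W^T *m (f - D *m g)).
  rewrite -!mulmxA; congr (_ *m _); apply/colP => i.
  rewrite invD toC_diagE mxE -/(U (e k.+1) i) -[RHS]/(U _ i) res.
  have -> : U (e k.+1) i = ((l 0 i)%:C)%C *
      (u k i - \sum_j g j 0 * (u (k - m + j).+1 i - u (k - m + j)%N i)).
    rewrite /e xk1 Gxs addrAC addrK UB UA Usum mulrBr mulr_sumr.
    congr (_ - _); apply: eq_bigr => j _.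
    by rewrite GB UA Ux; ring.
  by rewrite rmorphM rmorphB rmorph1 fmorphV /= mulrA divfK.
have [q sq q_le] := chebyshev_residual m lt_ab ab0 ab1.
have max_ge0 : 0 <= max_abs_diag Sig by rewrite bigmax_ge_id.
have rate_ge0 : 0 <= aa_rate a b m by rewrite invr_ge0.
rewrite errE -distE.
(* Division by a zero maximum yields 0, so the left side vanishes. *)
have [max0|max_neq0] := eqVneq (max_abs_diag Sig) 0.
  by rewrite max0 invr0 mulr0 mulr_ge0 ?norm2_ge0.
rewrite ler_pdivrMr ?lt_def ?max_neq0 // mulrC mulrA.
(* Minimality is tested against the coefficients of the Chebyshev-based [q]. *)
apply: (le_trans (g_min (\col_j ((q`_j)%:C)%C))); rewrite distE.
apply: norm2_le_scale => [|i]; first exact: mulr_ge0.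
rewrite SigE toC_diagE -/(U _ _) res_poly // -!mulmxA invD toC_diagE mxE.
rewrite -/(U _ _) UA -/(u k i) uk !Normc.normcM !normc_real.
have -> : Normc.normc (((l 0 i)%:C)%C ^+ m) = `|l 0 i| ^+ m.
  by rewrite -rmorphXn normc_real normrX.
rewrite -SigE normrM normf_div.
have sle : `|s 0 i| <= max_abs_diag Sig.
  by have := norm_le_max_abs_diag Sig i; rewrite SigE mxE eqxx.
have := q_le _ (l_in i); rewrite -/(aa_rate a b m) => qi.
have n0 : `|l 0 i| != 0 by rewrite normr_eq0.
(* Regrouping lets the weight [s 0 i] and the residual polynomial be bounded separately. *)
have -> : max_abs_diag Sig * aa_rate a b m *
    (`|l 0 i - 1| / `|l 0 i| * (`|l 0 i| * (`|l 0 i| ^+ m * Normc.normc (w i))))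
  = max_abs_diag Sig * (`|l 0 i - 1| * (aa_rate a b m * `|l 0 i| ^+ m)
      * Normc.normc (w i)) by field.
apply: ler_pM => //; first by rewrite !mulr_ge0 ?normc_ge0.
by rewrite ler_wpM2r ?normc_ge0 // ler_wpM2l.
Qed.
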